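(* Let $n \geq 2$ be an integer, and let $\mathbb{F}$ be a finite field of size $q$ such that $\mathrm{char}(\mathbb{F}) \mid n$. Consider the factorization of $x^n - 1$ into irreducible elements of $\mathbb{F}[x]$: \[ x^n -1 = p_1(x)^{m_1} p_2(x)^{m_2} \cdots p_r(x)^{m_r}, \] where $p_1(x),\dots,p_r(x)$ are pairwise non-associate irreducible polynomials and $m_i\geq 1$. For each $i = 1, \dots, r$, let $d_i := \deg(p_i(x))$. Then the number of vN-regular elements in $\mathrm{LCA}(\mathbb{Z}_n; \mathbb{F})$ is exactly \[ \prod_{i=1}^{r} \left( ( q^{d_i} - 1) q^{d_i (m_i-1)} +1 \right). \]
   Context: $\mathbb{Z}_n$ is the cyclic group of order $n$. Functions are applied on the right, and $\tau\sigma$ means first $\tau$, then $\sigma$. For a group $G$ and a set $A$, $G$ acts on $A^G$ (the set of all functions $G\to A$) by $(h)(x\cdot g) := (hg^{-1})x$. A cellular automaton over $A^G$ is a map $\tau : A^G \to A^G$ for which there exist a finite subset $S \subseteq G$ and a function $\mu : A^S \to A$ such that $(g)(x)\tau = ((x\cdot g^{-1})|_S)\mu$ for all $x\in A^G$, $g\in G$; $\mathrm{CA}(G;A)$ is the monoid of all of them under composition. Regarding a field $\mathbb{F}$ as a one-dimensional vector space over itself, $\mathbb{F}^G$ is a vector space with pointwise operations, and $\mathrm{LCA}(G;\mathbb{F})=\mathrm{CA}(G;\mathbb{F})\cap \mathrm{End}_{\mathbb{F}}(\mathbb{F}^G)$ is the monoid (under composition) of all $\mathbb{F}$-linear cellular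 automata over $\mathbb{F}^G$. An element $\tau\in\mathrm{LCA}(G;\mathbb{F})$ is vN-regular if there exists $\sigma\in\mathrm{LCA}(G;\mathbb{F})$ with $\tau\sigma\tau=\tau$. *)

(* Defs.v *)
From HB Require Import structures.
From mathcomp Require Import all_boot all_order all_fingroup all_algebra.

Set Implicit Arguments.
Unset Strict Implicit.
Unset Printing Implicit Defensive.

Import GRing.Theory.

Local Open Scope ring_scope.

(* The group G is finite and written multiplicatively, so that
   all the function spaces below are finite types: in particular every
   S : {set G} is a finite subset, and A^S is {ffun {h : G | h \in S} -> A}.
   The group law 'Z_n carries in group_scope is addition modulo n
   (for n >= 2, the range in which 'Z_n has n elements). *)

Section CellularAutomata.

Variables (G : finGroupType) (A : finType).

Implicit Types (x : {ffun G -> A}) (g : G) (S : {set G}).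

Definition shift x g : {ffun G -> A} := [ffun h => x (h * g^-1)%g].

Definition restrict S x : {ffun {h : G | h \in S} -> A} := [ffun s => x (val s)].

Definition CA : {set {ffun {ffun G -> A} -> {ffun G -> A}}} :=
  [set tau : {ffun {ffun G -> A} -> {ffun G -> A}} |
    [exists S : {set G},
     [exists mu : {ffun {ffun {h : G | h \in S} -> A} -> A},
     [forall x : {ffun G -> A}, [forall g : G,
       tau x g == mu (restrict S (shift x g^-1%g))]]]]].

(* Maps act on the right: mulCA tau sigma is "first tau, then sigma". *)
Definition mulCA (tau sigma : {ffun {ffun G -> A} -> {ffun G -> A}}) :
    {ffun {ffun G -> A} -> {ffun G -> A}} :=
  [ffun x => sigma (tau x)].

End CellularAutomata.

Section LinearCellularAutomata.

Variables (G : finGroupType) (F : finFieldType).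

Notation endo := {ffun {ffun G -> F^o} -> {ffun G -> F^o}}.

(* The boolean form of [linear tau], for the pointwise vector space structure
   of {ffun G -> F^o}; F^o is F as a vector space over itself. *)
Definition linearb (tau : endo) : bool :=
  [forall a : F, [forall x : {ffun G -> F^o}, [forall y : {ffun G -> F^o},
    tau (a *: x + y) == a *: tau x + tau y]]].

Definition LCA : {set endo} := CA G F^o :&: [set tau : endo | linearb tau].

Definition vN_regular (tau : endo) : bool :=
  [exists sigma in LCA, mulCA (mulCA tau sigma) tau == tau].

End LinearCellularAutomata.

(* Main.v *)
(* The maps x |-> sum_i a_i x(_ + i), for a in F[x], exhaust LCA(Z_n; F), which
   is thus isomorphic to F[x]/(x^n - 1): the polynomial of tau is read off the
   values of tau on the delta functions.  As a and ab - 1 are coprime, the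
   class of a is von Neumann regular, i.e. x^n - 1 divides a(ab - 1) for some b,
   iff for each i the polynomial a is zero or a unit modulo p_i^m_i.  By the
   Chinese remainder theorem the number of such classes is the product of the
   local counts; among the q^(d m) residues modulo p^m, there is one zero, and
   the q^(d (m - 1)) multiples of p are the non-units. *)
Require Import Defs.
From HB Require Import structures.
From mathcomp Require Import all_boot all_order all_fingroup all_algebra.

Import GRing.Theory.
Local Open Scope ring_scope.

(** * Divisibility by products of pairwise coprime polynomials *)

Lemma coprimep_prodr (F : fieldType) (I : eqType) (i : I) (s : seq I)
    (f : I -> {poly F}) :
  i \notin s -> (forall i j, i != j -> coprimep (f i) (f j)) ->
  coprimep (f i) (\prod_(j <- s) f j).
Proof.
move=> iNs cop; rewrite big_seq.
apply: (big_ind (fun g => coprimep (f i) g)) => [|g h cg ch|j js].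
- exact: coprimep1.
- by rewrite coprimepMr cg ch.
by apply: cop; apply: contraNneq iNs => ->.
Qed.

Lemma dvdp_prod_coprime (F : fieldType) (I : eqType) (s : seq I)
    (f : I -> {poly F}) (a : {poly F}) :
  uniq s -> (forall i j, i != j -> coprimep (f i) (f j)) ->
  (\prod_(i <- s) f i %| a) = all (fun i => f i %| a) s.
Proof.
move=> + cop; elim: s => [|i s IHs] /=; first by rewrite big_nil dvd1p.
case/andP=> iNs uniq_s; rewrite big_cons Gauss_dvdp ?IHs //.
exact: coprimep_prodr.
Qed.

(** * Counting residue classes, and regularity modulo a product of prime powers *)

Section PolynomialCounting.

Variable F : finFieldType.
Implicit Types (a b f g h p : {poly F}) (P Q : pred {poly F}).

(** Row vectors of length [k] stand for the residues modulo a polynomial of degree [k], which makes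
    the count finite. *)
Definition polycount (k : nat) (P : pred {poly F}) : nat :=
  #|[set v : 'rV[F]_k | P (rVpoly v)]|.

Lemma size_rVpoly k (v : 'rV[F]_k) : (size (rVpoly v) <= k)%N.
Proof. exact: size_poly. Qed.

Lemma rVpoly_inj k : injective (@rVpoly F k).
Proof. exact: can_inj rVpolyK. Qed.

Lemma size_modp_pred a g : g != 0 -> (size (a %% g)%R <= (size g).-1)%N.
Proof.
by move=> g0; rewrite -ltnS prednK ?size_poly_gt0 // ltn_modp.
Qed.

(** Chinese remainder theorem in counting form: reduction modulo [g] and [h] is injective, hence
    bijective by cardinality. *)
Lemma polycountM g h P Q :
    g != 0 -> h != 0 -> coprimep g h ->
    (forall a, P (a %% g) = P a) -> (forall a, Q (a %% h) = Q a) ->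
  polycount (size (g * h)%R).-1 (fun a => P a && Q a) =
  (polycount (size g).-1 P * polycount (size h).-1 Q)%N.
Proof.
move=> g0 h0 cgh Pg Qh; rewrite /polycount.
set k := (size (g * h)%R).-1.
have gt0 := size_poly_gt0.
have Dk : k = ((size g).-1 + (size h).-1)%N.
  rewrite /k size_mul //; have := gt0 _ g; have := gt0 _ h; rewrite g0 h0.
  by case: (size g) (size h) => [|a] [|b] // _ _; rewrite addnS addSn.
pose f (v : 'rV[F]_k) : 'rV[F]_(size g).-1 * 'rV[F]_(size h).-1 :=
  (poly_rV (rVpoly v %% g), poly_rV (rVpoly v %% h)).
have f_inj : injective f.
  move=> v w [/(congr1 rVpoly) + /(congr1 rVpoly)].
  rewrite !poly_rV_K ?size_modp_pred // => eg eh.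
  apply: rVpoly_inj; apply/eqP; rewrite -subr_eq0; apply: contraTT isT => nz.
  (* The difference has size at most [k], one less than the size of [g * h], so it cannot be a
     nonzero multiple. *)
  have: g * h %| rVpoly v - rVpoly w.
    rewrite Gauss_dvdp //; apply/andP; split; apply/modp_eq0P.
      by rewrite modpD modpN eg subrr.
    by rewrite modpD modpN eh subrr.
  move/(dvdp_leq nz); rewrite leqNgt => /negP[].
  rewrite -[size (g * h)]prednK ?gt0 ?mulf_neq0 // ltnS.
  by rewrite -raddfB size_rVpoly.
have f_bij : bijective f.
  apply: inj_card_bij f_inj _; rewrite card_prod !card_mx !mul1n -expnD.
  by rewrite Dk.
rewrite -cardsX -(on_card_preimset (f := f)); last exact: onW_bij.
apply: eq_card => v; rewrite !inE /= !poly_rV_K ?size_modp_pred //.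
by rewrite Pg Qh.
Qed.

Lemma modp_modp_dvd a g h : g %| h -> (a %% h) %% g = a %% g.
Proof.
move=> gh; rewrite [in RHS](divp_eq a h) modpD.
by rewrite (modp_eq0P _ _ (dvdp_mull _ gh)) add0r.
Qed.

Lemma polycount_prod (I : eqType) (s : seq I) (f : I -> {poly F})
    (P : I -> pred {poly F}) :
    uniq s -> (forall i, f i != 0) ->
    (forall i j, i != j -> coprimep (f i) (f j)) ->
    (forall i a, P i (a %% f i) = P i a) ->
  polycount (size (\prod_(i <- s) f i)%R).-1 (fun a => all (P^~ a) s) =
  (\prod_(i <- s) polycount (size (f i)).-1 (P i))%N.
Proof.
move=> + f0 cop Pf; elim: s => [_|i s IHs /= /andP[iNs uniq_s]].
  (* The empty product has size 1, which leaves the single row vector of length 0. *)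
  rewrite !big_nil size_poly1 /polycount /= -[RHS](expn0 #|F|).
  by rewrite -(muln0 1) -(card_mx F 1 0) -cardsT; apply: eq_card => v; rewrite !inE.
rewrite !big_cons -IHs // polycountM //.
- by rewrite prodf_seq_neq0; apply/allP => j _; rewrite f0.
- exact: coprimep_prodr.
move=> a; apply: eq_in_all => j js; rewrite -Pf modp_modp_dvd ?Pf //.
by rewrite (big_rem j) //= dvdp_mulr.
Qed.

(** Multiplication by [p] maps the polynomials of size at most [k] bijectively onto the multiples
    counted here. *)
Lemma polycount_dvdp k p : p != 0 ->
  polycount (k + (size p).-1) (fun a => p %| a) = (#|F| ^ k)%N.
Proof.
move=> p0; rewrite -(mul1n k) -(card_mx F 1 k) mul1n.
pose f (v : 'rV[F]_k) : 'rV[F]_(k + (size p).-1) := poly_rV (rVpoly v * p).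
have fE v : rVpoly (f v) = rVpoly v * p.
  rewrite poly_rV_K // (leq_trans (size_polyMleq _ _)) //.
  have: (0 < size p)%N by rewrite size_poly_gt0.
  case: (size p) => // t _; rewrite addnS /= leq_add2r; exact: size_rVpoly.
have f_inj : injective f.
  move=> v w /(congr1 rVpoly); rewrite !fE => /(mulIf p0); exact: rVpoly_inj.
rewrite -(card_imset _ f_inj); apply: eq_card => v; rewrite !inE.
apply/idP/imsetP => [/dvdpP[b bE]|[w _ ->]]; last by rewrite fE dvdp_mull.
exists (poly_rV b) => //; apply: rVpoly_inj; rewrite fE bE poly_rV_K //.
have [->|b0] := eqVneq b 0; first by rewrite size_poly0.
have := size_rVpoly _ v; rewrite bE size_mul //.
have: (0 < size p)%N by rewrite size_poly_gt0.
by case: (size p) => // t _; rewrite addnS /= leq_add2r.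
Qed.

(* For irreducible p and m > 0: the class of a modulo p ^+ m is zero or a unit. *)
Definition unit_or_zero p m : pred {poly F} :=
  fun a => (p ^+ m %| a) || ~~ (p %| a).

Lemma unit_or_zero_modp p m a : (0 < m)%N ->
  unit_or_zero p m (a %% p ^+ m) = unit_or_zero p m a.
Proof.
move=> m0; rewrite /unit_or_zero -(dvdp_mod _ (dvdpp _)).
by rewrite -(dvdp_mod a (dvdp_exp m0 (dvdpp p))).
Qed.

Lemma polycount_unit_or_zero p m : irreducible_poly p -> (0 < m)%N ->
  let q := #|F| in let d := (size p).-1 in
  polycount (size (p ^+ m)%R).-1 (unit_or_zero p m) =
  ((q ^ d - 1) * q ^ (d * (m - 1)) + 1)%N.
Proof.
move=> [sp _] m0 q d; have p0 : p != 0 by rewrite -size_poly_gt0 ltnW.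
rewrite size_exp -/d.
have c1 : polycount (d * m) (fun a => p ^+ m %| a) = 1%N.
  by rewrite -(expn0 #|F|) -(polycount_dvdp 0 (p ^+ m)) ?expf_neq0 // size_exp.
have c2 : polycount (d * m) (fun a => p %| a) = (q ^ (d * (m - 1)))%N.
  rewrite -(polycount_dvdp _ p) // -/d.
  by rewrite -[X in (_ + X)%N]muln1 -mulnDr subnK.
have -> : polycount (d * m) (unit_or_zero p m) =
    (polycount (d * m) (fun a => p ^+ m %| a)%R +
     polycount (d * m) (fun a => ~~ (p %| a))%R)%N.
  (* As [m] is positive, multiples of [p ^+ m] are multiples of [p], so the intersection term
     vanishes. *)
  rewrite /polycount -cardsUI.
  rewrite [X in (_ + X)%N]eq_card0 ?addn0 => [|v]; last first.
    rewrite !inE; apply/negP=> /andP[pm /negP[]].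
    exact: dvdp_trans (dvdp_exp m0 (dvdpp p)) pm.
  by apply: eq_card => v; rewrite !inE.
rewrite c1 addnC; congr (_ + 1)%N.
rewrite mulnBl mul1n -expnD -c2.
have -> : (d + d * (m - 1) = d * m)%N by rewrite -{1}(muln1 d) -mulnDr subnKC.
have -> : (q ^ (d * m) = #|{: 'rV[F]_(d * m)}|)%N by rewrite card_mx mul1n.
rewrite -(cardC (mem [set v : 'rV[F]_(d * m) | p %| rVpoly v])) addKn.
by apply: eq_card => v; rewrite !inE.
Qed.

Lemma quasi_inverse_mod_prod (I : finType) (p : I -> {poly F})
    (m : I -> nat) (a : {poly F}) :
    (forall i, irreducible_poly (p i)) ->
    (forall i j, i != j -> coprimep (p i) (p j)) -> (forall i, (0 < m i)%N) ->
  (exists b, \prod_i p i ^+ m i %| a * b * a - a) <->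
  (forall i, unit_or_zero (p i) (m i) a).
Proof.
move=> irr cop m0; set f := \prod_i _.
have copm i j : i != j -> coprimep (p i ^+ m i) (p j ^+ m j).
  by move=> ij; rewrite coprimep_expl // coprimep_expr // cop.
have f_dvd c : (f %| c) = all (fun i => p i ^+ m i %| c) (index_enum I).
  by rewrite dvdp_prod_coprime // index_enum_uniq.
split=> [[b fab] i | reg].
  have: p i ^+ m i %| a * b * a - a.
    by move: fab; rewrite f_dvd => /allP -> //; rewrite mem_index_enum.
  rewrite /unit_or_zero orbC; case: (boolP (p i %| a)) => //= pa.
  (* When [p i] divides [a] it is coprime to [a * b - 1], so the full power must divide [a]. *)
  have -> : a * b * a - a = a * (a * b - 1).
    by rewrite mulrBr mulr1 mulrC.
  rewrite Gauss_dvdpl // coprimep_expl // irreducible_poly_coprime //.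
  rewrite dvdp_subr ?dvdp_mulr // dvdp1; have [lt1 _] := irr i.
  by rewrite neq_ltn lt1 orbT.
(* [h] collects the prime powers at which [a] is a unit. It is coprime to [a], and [a * h] is zero
   modulo [f], so the Bezout coefficient [u] of [a] is a quasi-inverse. *)
pose h := \prod_(i | ~~ (p i %| a)) p i ^+ m i.
have f_ah : f %| a * h.
  rewrite f_dvd; apply/allP=> i _; have /orP[/dvdp_mulr->//|pa] := reg i.
  by rewrite /h (bigD1 i) //= dvdp_mull // dvdp_mulr.
have /Bezout_eq1_coprimepP[[u v] /= uv] : coprimep a h.
  apply: (big_ind (fun g => coprimep a g)) => [|g k cg ck|i pa].
    exact: coprimep1.
    by rewrite coprimepMr cg ck.
  by rewrite coprimep_expr // coprimep_sym irreducible_poly_coprime.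
exists u; have -> : a * u * a - a = - v * (a * h).
  have -> : a * u * a - a = (u * a - 1) * a by rewrite mulrBl mul1r [a * u]mulrC.
  by rewrite -uv opprD addrA subrr add0r mulNr mulNr -mulrA [h * a]mulrC.
by rewrite dvdp_mull.
Qed.

End PolynomialCounting.

(** * The action of polynomials on configurations *)

Section PolynomialAutomata.

Variables (F : finFieldType) (n' : nat).
(** With this form of the modulus, ['Z_n] and ['I_n] are convertible, so summation indices are group
    elements. *)
Local Notation n := n'.+2.
Local Notation V := {ffun 'Z_n -> F^o}.
Implicit Types (a b : {poly F}) (x y : V) (g : 'Z_n).

Definition polyact a x : V := [ffun g => \sum_(i < size a) a`_i *: x (g + i%:R)].

(** Coefficients past the size are zero; a common range allows termwise comparison of different
    polynomials. *)
Lemma polyact_wide k a x g : (size a <= k)%N ->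
  polyact a x g = \sum_(i < k) a`_i *: x (g + i%:R).
Proof.
move=> le_ak; rewrite ffunE (big_ord_widen k (fun i => a`_i *: x (g + i%:R))) //.
rewrite big_mkcond; apply: eq_bigr => i _; case: ltnP => // /(nth_default 0) ->.
by rewrite scale0r.
Qed.

Lemma polyactD a b x : polyact (a + b) x = polyact a x + polyact b x.
Proof.
apply/ffunP=> g; rewrite [RHS]ffunE.
rewrite !(@polyact_wide (maxn (size a) (size b))) ?leq_maxl ?leq_maxr //.
  by rewrite -big_split; apply: eq_bigr => i _; rewrite coefD scalerDl.
exact: size_polyD.
Qed.

Lemma polyactC c x : polyact c%:P x = c *: x.
Proof.
apply/ffunP=> g; rewrite [RHS]ffunE (@polyact_wide 1) ?size_polyC_leq1 //.
by rewrite big_ord1 coefC addr0.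
Qed.

Lemma polyactMX a x g : polyact (a * 'X) x g = polyact a x (g + 1).
Proof.
rewrite (@polyact_wide (size a).+1) ?big_ord_recl; last first.
  by rewrite (leq_trans (size_polyMleq _ _)) // size_polyX addn2.
rewrite coefMX scale0r add0r ffunE; apply: eq_bigr => i _.
by rewrite coefMX /= /bump add1n -natr1 [_ + 1]addrC addrA.
Qed.

(** Horner induction on [a] reduces this to constants and to ['X], which acts by translation. *)
Lemma polyactM a b x : polyact (a * b) x = polyact a (polyact b x).
Proof.
elim/poly_ind: a => [|a c IHa].
  by rewrite mul0r -polyC0 !polyactC !scale0r.
rewrite mulrDl !polyactD -mulrA ['X * b]mulrC mulrA polyactC; congr (_ + _).
  by apply/ffunP=> g; rewrite !polyactMX IHa.
apply/ffunP=> g; rewrite mul_polyC (@polyact_wide (size b)) ?size_scale_leq //.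
rewrite !ffunE scaler_sumr; apply: eq_bigr => i _.
by rewrite coefZ scalerA.
Qed.

Lemma polyactN a x : polyact (- a) x = - polyact a x.
Proof. by rewrite -mulN1r -polyC1 -polyCN polyactM polyactC scaleN1r. Qed.

Lemma polyactXn k x g : polyact 'X^k x g = x (g + k%:R).
Proof.
elim: k g => [|k IHk] g; first by rewrite expr0 -polyC1 polyactC scale1r addr0.
by rewrite exprSr polyactMX IHk -addrA -[k.+1%:R]nat1r.
Qed.

Lemma polyact_linear a c x y :
  polyact a (c *: x + y) = c *: polyact a x + polyact a y.
Proof.
apply/ffunP=> g; rewrite !ffunE scaler_sumr -big_split.
by apply: eq_bigr => i _; rewrite !ffunE scalerDr !scalerA mulrC.
Qed.

Lemma polyact_Xn1 x : polyact ('X^n - 1) x = 0.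
Proof.
rewrite polyactD polyactN -polyC1 polyactC scale1r; apply/ffunP=> g.
by rewrite [LHS]ffunE [X in _ + X]ffunE polyactXn pchar_Zp // addr0 subrr ffunE.
Qed.

Definition delta (h : 'Z_n) : V := [ffun g => (g == h)%:R].

Lemma polyact_delta a (i : 'Z_n) : (size a <= n)%N ->
  polyact a (delta i) 0 = a`_i.
Proof.
move=> le_an; rewrite (@polyact_wide n) // (bigD1 i) //= big1 => [|j ji].
  by rewrite addr0 ffunE add0r natr_Zp eqxx /GRing.scale /= mulr1.
by rewrite ffunE add0r natr_Zp (negPf ji) scaler0.
Qed.

Lemma polyact0r a : polyact a 0 = 0.
Proof.
by apply/ffunP=> g; rewrite !ffunE big1 // => i _; rewrite ffunE scaler0.
Qed.

Lemma size_Xn1 : size ('X^n - 1 : {poly F}) = n.+1.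
Proof. by rewrite -polyC1 size_XnsubC. Qed.

(** The remainder modulo ['X^n - 1] acts as [a] does and has size at most [n], so delta functions
    detect each of its coefficients. *)
Lemma polyact_eq0 a : (forall x, polyact a x = 0) <-> 'X^n - 1 %| a.
Proof.
split=> [a0|/dvdpP[b ->] x]; last by rewrite polyactM polyact_Xn1 polyact0r.
have r0 x : polyact (a %% ('X^n - 1)) x = 0.
  have := a0 x; rewrite [a in polyact a](divp_eq a ('X^n - 1)) polyactD polyactM.
  by rewrite polyact_Xn1 polyact0r add0r.
have sr : (size (a %% ('X^n - 1))%R <= n)%N.
  by rewrite -ltnS -size_Xn1 ltn_modp -size_poly_gt0 size_Xn1.
apply/modp_eq0P/polyP=> i; rewrite coef0.
have [lt_in|] := ltnP i n; last by move/(leq_trans sr)/(nth_default 0).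
by rewrite -(polyact_delta _ (Ordinal lt_in) sr) r0 ffunE.
Qed.

(** * Linear cellular automata as polynomials *)

Definition polyCA a : {ffun V -> V} := [ffun x => polyact a x].

Lemma polyCA_LCA a : polyCA a \in LCA 'Z_n F.
Proof.
rewrite inE; apply/andP; split; last first.
  rewrite inE; apply/forallP=> c; apply/forallP=> x; apply/forallP=> y.
  by rewrite !ffunE polyact_linear.
rewrite inE; apply/existsP; exists [set: 'Z_n].
(* With the whole group as memory set, the local rule is evaluation of the action at 0. *)
pose mu (z : {ffun {h : 'Z_n | h \in [set: 'Z_n]} -> F^o}) : F^o :=
  polyact a [ffun h => z (exist _ h (in_setT h))] 0.
apply/existsP; exists (finfun mu); apply/forallP=> x; apply/forallP=> g.
rewrite !ffunE /mu !ffunE; apply/eqP; apply: eq_bigr => i _; rewrite !ffunE /= invgK.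
by rewrite add0r [g + _]addrC.
Qed.

(** The same local rule applies at every cell, so an automaton is determined by its values at 0. *)
Lemma LCA_translate (tau : {ffun V -> V}) x g : tau \in LCA 'Z_n F ->
  tau x g = tau [ffun h => x (h + g)] 0.
Proof.
rewrite inE => /andP[+ _]; rewrite inE => /existsP[S /existsP[mu]].
move/forallP=> muE; have /forallP tE := muE x.
rewrite (eqP (tE g)); have /forallP/(_ 0)/eqP -> := muE [ffun h => x (h + g)].
congr (mu _); apply/ffunP=> s; rewrite !ffunE !invgK.
(* The group product of ['Z_n] unfolds to addition, with identity 0. *)
by congr (x _); rewrite -[RHS]/(val s + 0 + g) addr0.
Qed.

Lemma LCA_linear (tau : {ffun V -> V}) : tau \in LCA 'Z_n F ->
  forall c x y, tau (c *: x + y) = c *: tau x + tau y.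
Proof.
rewrite inE => /andP[_]; rewrite inE => /forallP lin c x y.
by have /forallP/(_ x)/forallP/(_ y)/eqP := lin c.
Qed.

Lemma LCA_polyCA (tau : {ffun V -> V}) : tau \in LCA 'Z_n F ->
  exists2 a : {poly F}, (size a <= n)%N & tau = polyCA a.
Proof.
move=> tauL; pose t (i : nat) : F := tau (delta i%:R) 0.
exists (\poly_(i < n) t i); first exact: size_poly.
have lin := LCA_linear _ tauL.
have tauD : {morph tau : x y / x + y}.
  by move=> x y; rewrite -[x]scale1r lin !scale1r.
have tau0 : tau 0 = 0 by apply: (addrI (tau 0)); rewrite -tauD !addr0.
apply/ffunP=> x; apply/ffunP=> g.
rewrite (LCA_translate _ _ _ tauL) [polyCA _ x]ffunE.
(* Expanding in delta functions turns linearity into a sum whose coefficients are the [t i]. *)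
set y := (X in tau X); have -> : y = \sum_h y h *: delta h.
  apply/ffunP=> h; rewrite sum_ffunE (bigD1 h) //= big1 => [|k kh].
    by rewrite [delta h]lock !ffunE -lock ffunE eqxx addr0 /GRing.scale /= mulr1.
  by rewrite !ffunE eq_sym (negPf kh) scaler0.
rewrite (big_morph tau tauD tau0) sum_ffunE (@polyact_wide n) ?size_poly //.
apply: eq_bigr => h _; rewrite coef_poly ltn_ord /t natr_Zp.
rewrite -[_ *: delta h]addr0 lin tau0 addr0 !ffunE.
by rewrite [h + g]addrC /GRing.scale /= mulrC.
Qed.

Lemma polyCA_eq a b : (polyCA a == polyCA b) = ('X^n - 1 %| a - b).
Proof.
apply/eqP/idP => [/ffunP ab | /polyact_eq0 ab].
  apply/polyact_eq0 => x; have := ab x; rewrite !ffunE polyactD polyactN => ->.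
  exact: subrr.
apply/ffunP=> x; rewrite !ffunE; apply/eqP; rewrite -subr_eq0.
by rewrite -polyactN -polyactD ab.
Qed.

(** Composition on the right gives [b * a]; commutativity restores the order. *)
Lemma mul_polyCA a b : mulCA (polyCA a) (polyCA b) = polyCA (a * b).
Proof. by apply/ffunP=> x; rewrite !ffunE mulrC polyactM. Qed.

Lemma vN_regular_polyCA a :
  vN_regular (polyCA a) <-> exists b, 'X^n - 1 %| a * b * a - a.
Proof.
split=> [/existsP[sigma /andP[/LCA_polyCA[b _ ->]]] | [b ab]].
  by rewrite !mul_polyCA polyCA_eq; exists b.
apply/existsP; exists (polyCA b); rewrite polyCA_LCA /=.
by rewrite !mul_polyCA polyCA_eq.
Qed.

End PolynomialAutomata.

(** * Transfer of the residue count to linear automata *)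

Theorem theorem9 (n : nat) (hn : (2 <= n)%N) (F : finFieldType)
    (c : nat) (hc : c \in [pchar F]) (hcn : (c %| n)%N)
    (r : nat) (p : 'I_r -> {poly F}) (m : 'I_r -> nat)
    (hp : forall i : 'I_r, irreducible_poly (p i))
    (hpp : forall i j : 'I_r, i != j -> ~~ (p i %= p j))
    (hm : forall i : 'I_r, (1 <= m i)%N)
    (hfact : 'X^n - 1 = \prod_(i < r) p i ^+ m i) :
  let q := #|F| in
  let d := fun i : 'I_r => (size (p i)).-1 in
  #|[set tau in LCA 'Z_n F | vN_regular tau]| =
    (\prod_(i < r) ((q ^ d i - 1) * q ^ (d i * (m i - 1)) + 1))%N.
Proof.
case: n hn {hc hcn} hfact => [|[|n]] // _ hfact q d.
have cop i j : i != j -> coprimep (p i) (p j).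
  (* If [p i] divided the irreducible [p j], the two would be associate. *)
  move=> ij; rewrite irreducible_poly_coprime //; apply: contra (hpp i j ij).
  by apply: (hp j).2; case: (hp i) => /gtn_eqF; rewrite eq_sym => ->.
have regE a : vN_regular (polyCA F n a) =
    all (fun i => unit_or_zero F (p i) (m i) a) (index_enum 'I_r).
  apply/idP/allP => [/vN_regular_polyCA | reg].
    by rewrite hfact => /quasi_inverse_mod_prod reg i _; apply: reg.
  apply/vN_regular_polyCA; rewrite hfact; apply/quasi_inverse_mod_prod => // i.
  exact/reg/mem_index_enum.
pose f (v : 'rV[F]_n.+2) := polyCA F n (rVpoly v).
(* Equal automata differ by a multiple of ['X^n.+2 - 1], whose size [n.+3] exceeds that of any
   difference of encoded polynomials. *)
have f_inj : injective f.
  move=> v w /eqP; rewrite polyCA_eq -raddfB => dv.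
  apply/eqP; rewrite -subr_eq0; apply: contraTT dv => nz.
  apply/negP=> /dvdp_leq; rewrite size_Xn1 ltnNge size_rVpoly => lt_size.
  by apply/notF/lt_size; rewrite raddf_eq0 ?nz //; exact: rVpoly_inj.
transitivity (polycount F n.+2
    (fun a => all (fun i => unit_or_zero F (p i) (m i) a) (index_enum 'I_r))).
  rewrite /polycount -(card_imset _ f_inj); apply: eq_card => tau.
  rewrite inE; apply/andP/imsetP => [[/LCA_polyCA[a sa ->]] | [v]].
    by rewrite regE => reg; exists (poly_rV a); rewrite ?inE /f poly_rV_K.
  by rewrite inE -regE => reg ->; rewrite polyCA_LCA.
(* The vector length is rewritten as the degree of the product, the form required by the Chinese
   remainder count. *)
rewrite -[n.+2]/(n.+3.-1) -(size_Xn1 F n) hfact polycount_prod.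
- by apply: eq_bigr => i _; rewrite polycount_unit_or_zero.
- exact: index_enum_uniq.
- by move=> i; rewrite expf_neq0 // -size_poly_gt0 ltnW // (hp i).1.
- by move=> i j ij; rewrite coprimep_expl // coprimep_expr // cop.
by move=> i a; rewrite unit_or_zero_modp.
Qed.
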